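(* Let $\beta>\alpha>-1$ be real numbers. Then $$\mathbb{M}^2(\alpha,\beta)\geq\frac{1}{2^{\beta-\alpha}}\,\frac{\Gamma(\beta+1)}{\Gamma(\alpha+1)}\left[\frac{\Gamma(1+\alpha/2)}{\Gamma(1+\beta/2)}\right]^2,$$ where $\Gamma$ is the Gamma function.
   Context: $\Delta=\{z\in\mathbb{C}:|z|<1\}$; $\mathcal{A}(\Delta)$ is the set of analytic functions on $\Delta$. For $\alpha>-1$, the weighted Bergman space is ${\bf A}_{\alpha}^2=\{\phi\in\mathcal{A}(\Delta): \|\phi\|_{\alpha}^2:=(\alpha+1)\iint_{\Delta}|\phi(z)|^2(1-|z|^2)^{\alpha}\frac{dx\,dy}{\pi}<\infty\}$. For $\gamma\in\mathbb{R}$, $\mathcal{B}_\gamma=\{\phi\in\mathcal{A}(\Delta):\|\phi\|_{\mathcal{B}_\gamma}:=\sup_{z\in\Delta}|\phi(z)|(1-|z|^2)^\gamma<\infty\}$. For $\beta>\alpha>-1$ it is known that multiplication by $g$ is bounded from ${\bf A}_\alpha^2$ to ${\bf A}_\beta^2$ if and only if $g\in\mathcal{B}_{(\beta-\alpha)/2}$; in this case the multiplier norm is $\|g\|_{{\bf M}_{\alpha,\beta}}:=\sup_{\phi\in{\bf A}_\alpha^2,\,\phi\neq0}\|g\phi\|_\beta/\|\phi\|_\alpha$. Define $$\mathbb{M}(\alpha,\beta):=\sup_{\|g\|_{\mathcal{B}_{(\beta-\alpha)/2}}=1}\|g\|_{{\bf M}_{\alpha,\beta}},$$ and $\mathbb{M}^2(\alpha,\beta)$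 denotes its square. *)

(* Defs.v *)
From HB Require Import structures.
From mathcomp Require Import all_boot all_order all_algebra.
From mathcomp Require Import all_classical all_reals all_analysis.
From mathcomp Require Import complex.

Set Implicit Arguments.
Unset Strict Implicit.
Unset Printing Implicit Defensive.

Import Order.TTheory GRing.Theory Num.Theory.
Import numFieldNormedType.Exports.

Local Open Scope classical_set_scope.
Local Open Scope ring_scope.
Local Open Scope complex_scope.

(* The modulus of a complex number as an element of R ([`|z|] lives in R[i]). *)
Notation cmod := ComplexField.Normc.normc.

Definition unit_disk (R : realType) : set R[i] := [set z | cmod z < 1].
Arguments unit_disk : clear implicits.

(* Functions on the disk are represented by total functions on R[i]: only their
   values on [unit_disk] matter in what follows. The increments in [derivable]
   range over R[i], so this is complex differentiability. *)
Definition analytic (R : realType) : set (R[i] -> R[i]) :=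
  [set f | forall z, unit_disk R z -> @derivable R[i] R[i]^o R[i]^o f z 1].

Arguments analytic : clear implicits.

Definition nonzero_on_disk (R : realType) (f : R[i] -> R[i]) : Prop :=
  exists2 z, unit_disk R z & f z <> 0.

Section bergman.
Variable R : realType.
Implicit Types (a b gamma x : R) (f g phi : R[i] -> R[i]).

Local Open Scope ereal_scope.

(* ||phi||_a^2, an integral for the planar Lebesgue measure dx dy. *)
Definition bergman_normsq a phi : \bar R :=
  (a + 1)%:E *
  \int[@lebesgue_measure R \x @lebesgue_measure R]_(p in
      [set p : R * R | unit_disk R (p.1 +i* p.2)])
    (cmod (phi (p.1 +i* p.2)) ^+ 2
     * (1 - cmod (p.1 +i* p.2) ^+ 2) `^ a / pi)%:E.

Definition bergman_norm a phi : \bar R := bergman_normsq a phi `^ 2^-1.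

Definition bergman_space a : set (R[i] -> R[i]) :=
  [set phi | analytic R phi /\ bergman_normsq a phi < +oo].

Definition growth_norm gamma phi : \bar R :=
  ereal_sup [set (cmod (phi z) * (1 - cmod z ^+ 2) `^ gamma)%:E
            | z in unit_disk R].

Definition growth_space gamma : set (R[i] -> R[i]) :=
  [set phi | analytic R phi /\ growth_norm gamma phi < +oo].

Definition multiplier_norm a b g : \bar R :=
  ereal_sup [set bergman_norm b (fun z => (g z * phi z)%R) / bergman_norm a phi
            | phi in [set phi | bergman_space a phi /\ nonzero_on_disk phi]].

Definition sup_multiplier_norm a b : \bar R :=
  ereal_sup [set multiplier_norm a b g
            | g in [set g | growth_space ((b - a) / 2) g
                            /\ growth_norm ((b - a) / 2) g = 1]].

(* Euler's integral: this is the Gamma function for 0 < x only. *)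
Definition Gamma x : R :=
  (\int[@lebesgue_measure R]_(t in `]0%R, +oo[) (t `^ (x - 1) * expR (- t)))%R.

End bergman.

(* Main.v *)
Require Import Defs.
From HB Require Import structures.
From mathcomp Require Import all_boot all_order all_algebra.
From mathcomp Require Import all_classical all_reals all_analysis.
From mathcomp Require Import complex.
From mathcomp Require Import ring lra measurable_realfun.

(* Testing with g = phi = 1, for which all the norms involved are 1, gives
   M(alpha, beta) >= 1, so it suffices that the right-hand side is at most 1.
   Put Q(e) = int_{-1}^{1} (1 - u^2)^e du. Slicing the integral
   D(a) = iint_disk (1 - x^2 - y^2)^a dx dy gives D(a) = Q(a) Q(a + 1/2),
   whereas a direct computation gives D(a) = pi / (a + 1); Euler's Beta integral
   gives Gamma(1 + a/2)^2 = 2^(-a - 1) Gamma(a + 2) Q(a/2). Hence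
   Gamma(a + 1) / (2^a Gamma(1 + a/2)^2) = Q((a - 1)/2) / pi, which decreases
   with a; the right-hand side is the quotient of its values at beta and
   alpha. *)

Set Implicit Arguments.
Unset Strict Implicit.
Unset Printing Implicit Defensive.

Import Order.TTheory GRing.Theory Num.Theory.
Import numFieldNormedType.Exports.

Local Open Scope ring_scope.

(** * Integration on the line: affine substitutions, Tonelli, improper integrals *)

Section real_integrals.
Variable R : realType.
Local Open Scope classical_set_scope.
Local Open Scope ring_scope.
Local Notation mu := (@lebesgue_measure R).

(** By uniqueness of Lebesgue measure it is enough to compare both sides on half-open intervals: [c]
    times the pushforward of [mu] under [x |-> c * x + d] gives []a, b]] its length. *)
Lemma lebesgue_measure_affine (c d : R) (A : set R) : 0 < c -> measurable A ->
  mu A = (c%:E * mu ((fun x => c * x + d)%R @^-1` A))%E.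
Proof.
move=> c0 mA.
have mphi : measurable_fun [set: measurableTypeR R]
    ((fun x => c * x + d) : _ -> measurableTypeR R).
  by apply: measurable_funD => //; apply: measurable_funM.
pose mphi_mixin := isMeasurableFun.Build _ _ _ _ _ mphi.
pose phi : {mfun measurableTypeR R >-> measurableTypeR R} :=
  HB.pack (fun x => c * x + d) mphi_mixin.
have -> := @lebesgue_measure_unique R
  (mscale (NngNum (ltW c0)) (pushforward mu phi)) _ A mA; first by [].
move=> _ [[a b]] _ <-.
change (mu `]a, b] = c%:E * mu ((fun x => c * x + d)%R @^-1` `]a, b]))%E.
rewrite (_ : _ @^-1` _ = `]((a - d) / c)%R, ((b - d) / c)%R]%classic);
  last first.
  apply/seteqP; split => x /=; rewrite !in_itv/= ltr_pdivrMr// ler_pdivlMr//;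
    by rewrite ltrBlDr lerBrDr (mulrC x).
rewrite !lebesgue_measure_itv/= !lte_fin ltr_pM2r ?invr_gt0// ltrD2r.
case: ifPn => _; last by rewrite mule0.
by rewrite -!EFinB -EFinM; congr EFin; field; rewrite gt_eqF.
Qed.

(** The right-hand side is an integral against the scaled pushforward of [mu], which is [mu] itself.
    Both sides may be infinite, so substitutions can be made before any convergence is known. *)
Lemma ge0_integral_affine (c d : R) (f : R -> \bar R) : 0 < c ->
  measurable_fun [set: R] f -> (forall x, (0 <= f x)%E) ->
  (\int[mu]_x f x = c%:E * \int[mu]_x f (c * x + d)%R)%E.
Proof.
move=> c0 mf f0.
have mphi : measurable_fun [set: measurableTypeR R]
    ((fun x => c * x + d) : _ -> measurableTypeR R).
  by apply: measurable_funD => //; apply: measurable_funM.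
pose mphi_mixin := isMeasurableFun.Build _ _ _ _ _ mphi.
pose phi : {mfun measurableTypeR R >-> measurableTypeR R} :=
  HB.pack (fun x => c * x + d) mphi_mixin.
have := @ge0_integral_pushforward _ _ (measurableTypeR R) (measurableTypeR R) R
  _ mphi mu setT f measurableT mf (fun x _ => f0 x).
rewrite preimage_setT => /= <-.
have := @ge0_integral_mscale _ (measurableTypeR R) R (pushforward mu phi) setT
  measurableT (NngNum (ltW c0)) f mf (fun x _ => f0 x).
move=> <-.
by apply: eq_measure_integral => /= A mA _; exact: lebesgue_measure_affine.
Qed.

Lemma ge0_integral_scale (c : R) (f : R -> \bar R) : 0 < c ->
  measurable_fun [set: R] f -> (forall x, (0 <= f x)%E) ->
  (\int[mu]_x f x = c%:E * \int[mu]_x f (c * x)%R)%E.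
Proof.
move=> c0 mf f0; rewrite (ge0_integral_affine 0 c0 mf f0).
by under [in RHS]eq_integral do rewrite -[(c * _)%R]addr0.
Qed.

Lemma ge0_integral_shift (d : R) (f : R -> \bar R) :
  measurable_fun [set: R] f -> (forall x, (0 <= f x)%E) ->
  (\int[mu]_x f x = \int[mu]_x f (x + d)%R)%E.
Proof.
move=> mf f0; rewrite (ge0_integral_affine d ltr01 mf f0) mul1e.
by apply: eq_integral => x _; rewrite mul1r.
Qed.

Lemma ge0_integral_swap (f : R -> R -> R) :
  measurable_fun [set: R * R] (fun p => f p.1 p.2) ->
  (forall x y, 0 <= f x y) ->
  (\int[mu]_x \int[mu]_y (f x y)%:E = \int[mu]_y \int[mu]_x (f x y)%:E)%E.
Proof.
move=> mf f0.
have mEf : measurable_fun [set: R * R] (fun p => (f p.1 p.2)%:E).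
  exact/measurable_EFinP.
have Ef0 (p : R * R) : (0 <= (f p.1 p.2)%:E)%E by rewrite lee_fin.
rewrite -(@fubini_tonelli2 _ _ (measurableTypeR R) (measurableTypeR R) R
  mu mu _ mEf Ef0).
by rewrite (@fubini_tonelli1 _ _ (measurableTypeR R) (measurableTypeR R) R
  mu mu _ mEf Ef0).
Qed.

Lemma ge0_continuous_FTC2oo (f F : R -> R) (a b : R) : a < b ->
  {in `]a, b[, forall x, 0 <= f x} ->
  {in `]a, b[, continuous f} ->
  {in `]a, b[, forall x : R, is_derive x 1 F (f x)} ->
  F x @[x --> a^'+] --> F a -> F x @[x --> b^'-] --> F b ->
  (\int[mu]_(x in `]a, b[) (f x)%:E = (F b - F a)%:E)%E.
Proof.
move=> ab f0 cf dF Fa Fb.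
(* The denominator starts at 3, so that [a + e n < b - e n] already for [n = 0]. *)
pose e (n : nat) : R := (b - a) / n.+3%:R.
have ba0 : 0 < b - a by rewrite subr_gt0.
have e0 n : 0 < e n by rewrite divr_gt0.
have e3 n : 3 * e n <= b - a.
  by rewrite /e mulrA ler_pdivrMr// mulrC ler_pM2l// ler_nat.
have en : e n @[n --> \oo] --> 0.
  rewrite -(mulr0 (b - a)).
  have -> : e = (fun n => (b - a) * harmonic (n + 2)%N).
    by apply/funext => n; rewrite /e /= addn2.
  by apply: cvgMr; rewrite (cvg_shiftn 2); exact: cvg_harmonic.
pose E n : set R := `[(a + e n), (b - e n)]%classic.
have edec m n : (m <= n)%N -> e n <= e m.
  by move=> mn; rewrite ler_pM2l// lef_pV2 ?posrE// ler_nat !ltnS.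
have EE : \bigcup_n E n = `]a, b[%classic.
  apply/seteqP; split => [x [n _]|x].
    rewrite /E/= !in_itv/= => /andP[h1 h2].
    by rewrite (lt_le_trans _ h1) ?ltrDl// (le_lt_trans h2)// ltrBlDr ltrDl.
  rewrite /= in_itv/= => /andP[h1 h2].
  have d0 : 0 < Num.min (x - a) (b - x) by rewrite lt_min !subr_gt0 h1.
  move/cvgrPdist_lt : en => /(_ _ d0)[N _ /(_ N (leqnn N))]/=.
  rewrite sub0r normrN gtr0_norm// lt_min => /andP[h3 h4].
  by exists N => //; rewrite /E/= in_itv/=; apply/andP; split; lra.
have subE n : E n `<=` `]a, b[ by rewrite -EE; exact: bigcup_sup.
have memE n x : x \in `[(a + e n), (b - e n)] -> x \in `]a, b[.
  by move=> h; have /= := subE n x h.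
have cfE n : {within E n, continuous f}.
  apply: continuous_in_subspaceT => x /set_mem xE.
  exact/cf/(memE n).
have mfE n : measurable_fun (E n) (fun x => (f x)%:E).
  apply/measurable_EFinP; apply: subspace_continuous_measurable_fun => //.
  exact: measurable_itv.
have h : ((\int[mu]_(x in E n) (f x)%:E) @[n --> \oo] -->
    \int[mu]_(x in \bigcup_n E n) (f x)%:E)%E.
  apply: ge0_nondecreasing_set_cvg_integral => //.
  - move=> m n mn; rewrite subsetEset => x.
    rewrite /E/= !in_itv/= => /andP[h1 h2].
    have := edec _ _ mn => h; apply/andP; split; lra.
  - by move=> n; exact: measurable_itv.
  - by move=> n x /memE xE; rewrite lee_fin f0.
rewrite -EE; apply/esym; apply: cvg_unique h => //.
have -> : (fun n => \int[mu]_(x in E n) (f x)%:E)%E =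
    EFin \o (fun n => F (b - e n) - F (a + e n)).
  apply/funext => n /=; rewrite EFinB; have := e3 n; have := e0 n => e0n e3n.
  apply: continuous_FTC2 => //; first by lra.
  - exact: cfE.
  - have cF x : x \in `]a, b[ -> {for x, continuous F}.
      move=> /dF h; apply/differentiable_continuous/derivable1_diffP.
      exact: ex_derive.
    split.
    + move=> x xab; have := @dF x => h; apply: ex_derive; apply: h.
      by apply: (memE n); exact: subset_itv_oo_cc xab.
    + apply: cvg_at_right_filter; apply: cF; apply: (memE n).
      by rewrite in_itv/= lexx/=; lra.
    + apply: cvg_at_left_filter; apply: cF; apply: (memE n).
      by rewrite in_itv/= lexx andbT; lra.
  - move=> x xab; rewrite derive1E; apply: derive_val.
    by apply: dF; apply: (memE n); exact: subset_itv_oo_cc xab.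
apply: cvg_EFin; first exact: nearW.
apply: cvgB.
- have /cvg_at_leftP := Fb; apply; split => [n|].
    by rewrite ltrBlDr ltrDl.
  by rewrite -[in X in _ --> X](subr0 b); apply: cvgB => //; exact: cvg_cst.
- have /cvg_at_rightP := Fa; apply; split => [n|].
    by rewrite ltrDl.
  by rewrite -[in X in _ --> X](addr0 a); apply: cvgD => //; exact: cvg_cst.
Qed.

End real_integrals.

(** * Truncated powers and the elementary integrals built from them *)

Section truncated_power.
Variable R : realType.
Local Open Scope classical_set_scope.
Local Open Scope ring_scope.
Local Notation mu := (@lebesgue_measure R).
Implicit Types a c d e m r s t u v x y : R.

(* The cut-off at [0] discards the values of [powR] on the negative axis, and
   [ppow 0] is the indicator function of the positive axis. *)
Definition ppow e t : R := if 0 < t then t `^ e else 0.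

Lemma ppow_gt0E e t : 0 < t -> ppow e t = t `^ e.
Proof. by rewrite /ppow => ->. Qed.

Lemma ppow_le0E e t : t <= 0 -> ppow e t = 0.
Proof. by rewrite /ppow ltNge => ->. Qed.

Lemma ppow_ge0 e t : 0 <= ppow e t.
Proof. by rewrite /ppow; case: ifP => // _; exact: powR_ge0. Qed.

Lemma ppowZ e c t : 0 < c -> ppow e (c * t) = c `^ e * ppow e t.
Proof.
move=> c0; rewrite /ppow pmulr_rgt0//; case: ifPn => [t0|_].
  by rewrite powRM ?ltW.
by rewrite mulr0.
Qed.

Lemma measurable_ppow e : measurable_fun [set: R] (ppow e).
Proof.
have mg : measurable_fun [set: R] (fun t : R => 0 < t).
  exact: measurable_fun_ltr.
by apply: (measurable_fun_ifT mg) => //; exact: measurable_powR.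
Qed.

Lemma measurable_ppow_comp (d : measure_display) (T : measurableType d) e
    (f : T -> R) :
  measurable_fun [set: T] f -> measurable_fun [set: T] (fun z => ppow e (f z)).
Proof. by move=> mf; apply: measurableT_comp => //; exact: measurable_ppow. Qed.

Lemma ppow_mul_sym e u : ppow e (1 + u) * ppow e (1 - u) = ppow e (1 - u ^+ 2).
Proof.
have -> : 1 - u ^+ 2 = (1 + u) * (1 - u) by ring.
have [u1|u1] := ltP 0 (1 + u); first by rewrite ppowZ// ppow_gt0E.
(* If [1 + u <= 0] then [1 - u] is positive, so the product is nonpositive and both sides are cut
   off. *)
rewrite (ppow_le0E _ u1) mul0r ppow_le0E//.
by apply: mulr_le0_ge0 => //; lra.
Qed.

Lemma continuous_powR_gt0 e s : 0 < s -> {for s, continuous (fun t => t `^ e)}.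
Proof.
move=> s0; apply/differentiable_continuous/derivable1_diffP.
by apply: ex_derive; exact: is_derive1_powR.
Qed.

(** The half line is expressed by the weight [ppow 0] rather than by the domain, so that the affine
    substitutions, stated for the whole line, still apply. *)
Lemma ge0_integral_even (f : R -> \bar R) :
  measurable_fun [set: R] f -> (forall x, 0 <= f x)%E ->
  (forall x, f (- x) = f x) ->
  (\int[mu]_x f x = 2%:E * \int[mu]_x ((ppow 0 x)%:E * f x))%E.
Proof.
move=> mf f0 fN.
have E0 : (\int[mu]_x ((ppow 0 x)%:E * f x) =
    \int[mu]_(x in `]0%R, +oo[) f x)%E.
  rewrite [RHS]integral_mkcond; apply: eq_integral => x _.
  rewrite patchE mem_setE in_itv/= andbT /ppow; case: ifPn => _.
    by rewrite powRr0 mul1e.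
  by rewrite mul0e.
rewrite E0; have -> : [set: R] = `]-oo, 0%R] `|` `]0%R, +oo[.
  apply/seteqP; split => x //= _; rewrite !in_itv/= andbT.
  by case: (leP x 0) => _; [left|right].
rewrite ge0_integral_setU//=; last 2 first.
- exact: measurable_funTS.
- apply/disj_setPS => x [/=]; rewrite !in_itv/= andbT => h1 h2.
  by move: (le_lt_trans h1 h2); rewrite ltxx.
have -> : (2%:E = 1 + 1 :> \bar R)%E by rewrite -EFinD.
rewrite ge0_muleDl// mul1e; congr adde.
(* The reflection [x |-> - x] is applied with closed half lines; the endpoint 0 is a null set. *)
rewrite integral_itv_obnd_cbnd; last exact: measurable_funTS.
rewrite ge0_integration_by_substitution0//.
by under [RHS]eq_integral do rewrite fN.
Qed.

(** This writes a power as the integral of a lower one. The factor [ppow 0 (t - s)] encodes [s < t]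
    in the integrand, which leaves the order of integration free to be exchanged. *)
Lemma integral_ppow_ppow0 e t : -1 < e ->
  (\int[mu]_s (ppow e s * ppow 0 (t - s))%:E = (ppow (e + 1) t / (e + 1))%:E)%E.
Proof.
move=> e1; have [t0|t0] := leP t 0.
  rewrite (ppow_le0E _ t0) mul0r; apply: integral0_eq => s _.
  have [s0|s0] := leP s 0; first by rewrite (ppow_le0E _ s0) mul0r.
  by rewrite (@ppow_le0E 0) ?mulr0// subr_le0 (le_trans t0)// ltW.
have ep : 0 < e + 1 by lra.
transitivity (\int[mu]_(s in `]0%R, t[) (s `^ e)%:E)%E.
  rewrite [RHS]integral_mkcond; apply: eq_integral => s _.
  rewrite patchE mem_setE in_itv/= /ppow subr_gt0.
  by case: ifPn => _; case: ifPn => _; rewrite ?mul0r ?mulr0// powRr0 mulr1.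
rewrite (@ge0_continuous_FTC2oo _ _ (fun s => s `^ (e + 1) / (e + 1)))//.
- by rewrite (@powR0 _ (e + 1)) ?gt_eqF// mul0r subr0 ppow_gt0E.
- by move=> s _; exact: powR_ge0.
- by move=> s; rewrite in_itv/= => /andP[s0 _]; exact: continuous_powR_gt0.
- move=> s; rewrite in_itv/= => /andP[s0 _].
  have h := @is_derive1_powR R (e + 1) s s0.
  have := @is_deriveM _ _ (fun t => t `^ (e + 1)) (cst (e + 1)^-1) _ _ _ _
    h (is_derive_cst _ _ _).
  move/is_derive_eq; apply.
  by rewrite scaler0 add0r addrK /= /GRing.scale/=; field; rewrite gt_eqF.
- rewrite (@powR0 _ (e + 1)) ?gt_eqF//.
  by apply: cvgMl; exact: powR_cvg0.
- apply: cvgMl; apply: cvg_at_left_filter.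
  exact: continuous_powR_gt0.
Qed.

Lemma integral_ppow1_ppow a : -1 < a ->
  (\int[mu]_v (ppow 1 v * ppow a (1 - v ^+ 2))%:E = (2 * (a + 1))^-1%:E)%E.
Proof.
move=> a1; have ap : 0 < a + 1 by lra.
transitivity (\int[mu]_(v in `]0%R, 1%R[) (v * (1 - v ^+ 2) `^ a)%:E)%E.
  rewrite [RHS]integral_mkcond; apply: eq_integral => v _.
  rewrite patchE mem_setE in_itv/= /ppow subr_gt0.
  case: ifPn => [v0|_]; last by rewrite mul0r.
  rewrite expr_lt1 ?ltW//.
  by case: ifPn => _; rewrite ?mulr0// powRr1 ?ltW.
have B v : v \in `]0, 1[ -> 0 < 1 - v ^+ 2.
  by rewrite in_itv/= => /andP[v0 v1]; rewrite subr_gt0 expr_lt1 ?ltW.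
have cB : continuous (fun v : R => 1 - v ^+ 2).
  by move=> v; apply: cvgB; [exact: cvg_cst|exact: exprn_continuous].
rewrite (@ge0_continuous_FTC2oo _ _
  (fun v => (1 - v ^+ 2) `^ (a + 1) * - (2 * (a + 1))^-1))//.
- rewrite expr1n subrr powR0 ?gt_eqF// expr0n/= subr0 powR1; congr EFin; ring.
- move=> v; rewrite in_itv/= => /andP[v0 _].
  by rewrite mulr_ge0 ?powR_ge0// ltW.
- move=> v v01; apply: cvgM; first exact: cvg_id.
  apply: (@continuous_comp _ _ _ (fun v => 1 - v ^+ 2) (fun t => t `^ a)).
    exact: cB.
  exact/continuous_powR_gt0/B.
- move=> v v01.
  have h1 := @is_derive1_powR R (a + 1) _ (B _ v01).
  have h2 : is_derive v 1 (fun v : R => 1 - v ^+ 2) (0 - 2 * v).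
    have h : is_derive v 1 (cst 1 - (@id R) ^+ 2 : R -> R) (0 - 2 * v).
      by apply: is_derive_eq; rewrite /GRing.scale/= expr1 mulr1 mulr_natl.
    exact: h.
  have h3 := @is_derive1_comp R (fun t => t `^ (a + 1)) _ v _ _ h1 h2.
  have := @is_deriveM _ _ _ (cst (- (2 * (a + 1))^-1)) _ _ _ _
    h3 (is_derive_cst _ _ _).
  move/is_derive_eq; apply.
  rewrite scaler0 add0r addrK /= /GRing.scale/=; field.
  by rewrite gt_eqF.
- apply: cvgMl; apply: cvg_at_right_filter.
  apply: (@continuous_comp _ _ _ (fun v => 1 - v ^+ 2) (fun t => t `^ (a + 1))).
    exact: cB.
  by apply: continuous_powR_gt0; rewrite expr0n/= subr0.
- rewrite expr1n subrr (@powR0 _ (a + 1)) ?gt_eqF//; apply: cvgMl.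
  (* The power has only a right-hand limit at 0, so [1 - v ^+ 2] has to be shown positive for [v]
     close to 1 on the left. *)
  apply: cvg_comp (@powR_cvg0 R (a + 1) ap) => A HA.
  have c1 : 1 - v ^+ 2 @[v --> (1:R)] --> (0:R).
    by have := cB 1; rewrite /continuous_at expr1n subrr.
  have H : \forall v \near (1:R), 0 < 1 - v ^+ 2 -> A (1 - v ^+ 2) := c1 _ HA.
  have HL : \forall v \near (1:R)^'-, 0 < 1 - v ^+ 2 -> A (1 - v ^+ 2).
    exact: cvg_within H.
  have H1 : \forall v \near (1:R)^'-, A (1 - v ^+ 2).
    near=> v.
    apply: (near HL v) => //; apply: B; rewrite in_itv/=; apply/andP; split;
      near: v.
      exact: nbhs_left_gt.
    exact: nbhs_left_lt.
  exact: H1.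
Unshelve. all: by end_near. Qed.
End truncated_power.

(** * The disk integral, its slices, and Euler's Gamma and Beta integrals *)

Section gamma_and_disk.
Variable R : realType.
Local Open Scope classical_set_scope.
Local Open Scope ring_scope.
Local Notation mu := (@lebesgue_measure R).
Implicit Types a b c e k m r s t u v x y : R.

Lemma ge0_integralZl_fin k (f : R -> R) : 0 <= k ->
  measurable_fun [set: R] f -> (forall x, 0 <= f x) ->
  (\int[mu]_x (k * f x)%:E = k%:E * \int[mu]_x (f x)%:E)%E.
Proof.
move=> k0 mf f0; rewrite -ge0_integralZl//; first exact/measurable_EFinP.
by move=> x _; rewrite lee_fin.
Qed.

Lemma measurable_fst_R : measurable_fun [set: R * R] (@fst R R).
Proof. exact: measurable_fst. Qed.

(** This is Q(e) of the overview, the cut-off confining [u] to []-1, 1[]. It takes extended real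
    values because its finiteness is only deduced later, from the disk integral. *)
Definition slice_integral e : \bar R := (\int[mu]_u (ppow e (1 - u ^+ 2))%:E)%E.

Definition disk_integral a : \bar R :=
  (\int[mu \x mu]_(z in [set: R * R]) (ppow a (1 - z.1 ^+ 2 - z.2 ^+ 2))%:E)%E.

Lemma measurable_disk_integrand a : measurable_fun [set: R * R]
  (fun z : R * R => (ppow a (1 - z.1 ^+ 2 - z.2 ^+ 2))%:E).
Proof.
have sx : measurable_fun [set: R * R] (fun z : R * R => z.1 ^+ 2).
  by apply: measurable_funX; exact: measurable_fst.
have sy : measurable_fun [set: R * R] (fun z : R * R => z.2 ^+ 2).
  by apply: measurable_funX; exact: measurable_snd.
apply/measurable_EFinP/measurable_ppow_comp.
by do 2 (apply: measurable_funB => //).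
Qed.

Lemma disk_integral_iterated a : disk_integral a =
  (\int[mu]_x \int[mu]_y (ppow a (1 - x ^+ 2 - y ^+ 2))%:E)%E.
Proof.
rewrite /disk_integral (@fubini_tonelli1 _ _ (measurableTypeR R)
  (measurableTypeR R) R mu mu _ (@measurable_disk_integrand a))// => z.
by rewrite lee_fin ppow_ge0.
Qed.

Lemma slice_integral_ge0 e : (0 <= slice_integral e)%E.
Proof. by apply: integral_ge0 => u _; rewrite lee_fin ppow_ge0. Qed.

Lemma measurable_ppow_sqr e :
  measurable_fun [set: R] (fun u => ppow e (1 - u ^+ 2)).
Proof.
by apply: measurable_ppow_comp; apply: measurable_funB.
Qed.

(** Where the integrand does not vanish, the base [1 - u ^+ 2] lies in []0, 1]], so raising the
    exponent lowers the power. *)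
Lemma slice_integral_nonincreasing e e' :
  e <= e' -> (slice_integral e' <= slice_integral e)%E.
Proof.
move=> ee'; apply: ge0_le_integral => //.
- by move=> u _; rewrite lee_fin ppow_ge0.
- by apply/measurable_EFinP; exact: measurable_ppow_sqr.
- by apply/measurable_EFinP; exact: measurable_ppow_sqr.
- move=> u _; rewrite lee_fin /ppow; case: ifPn => // u0.
  by apply: ger_powR => //; rewrite u0 lerBlDr lerDl sqr_ge0.
Qed.

Lemma disk_integral_slices a :
  disk_integral a = (slice_integral a * slice_integral (a + 2^-1))%E.
Proof.
rewrite disk_integral_iterated.
transitivity (\int[mu]_x
    ((ppow (a + 2^-1) (1 - x ^+ 2))%:E * slice_integral a))%E; last first.
  rewrite ge0_integralZr ?slice_integral_ge0//; first by rewrite muleC.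
    by apply/measurable_EFinP; exact: measurable_ppow_sqr.
  by move=> x _; rewrite lee_fin ppow_ge0.
apply: eq_integral => x _.
have [x1|x1] := ltP 0 (1 - x ^+ 2); last first.
  rewrite (ppow_le0E _ x1) mul0e; apply: integral0_eq => y _.
  by rewrite ppow_le0E// lerBlDr (le_trans x1)// add0r sqr_ge0.
set q := 1 - x ^+ 2 in x1 *.
have sq0 : 0 < Num.sqrt q by rewrite sqrtr_gt0.
rewrite (ge0_integral_scale sq0); last 2 first.
- apply/measurable_EFinP/measurable_ppow_comp/measurable_funB => //.
- by move=> y; rewrite lee_fin ppow_ge0.
transitivity ((Num.sqrt q)%:E * \int[mu]_u (q `^ a * ppow a (1 - u ^+ 2))%:E)%E.
  congr (_ * _)%E; apply: eq_integral => u _.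
  by rewrite -ppowZ// exprMn sqr_sqrtr ?ltW// mulrBr mulr1.
rewrite ge0_integralZl_fin ?powR_ge0//; last 2 first.
- exact: measurable_ppow_sqr.
- by move=> u; exact: ppow_ge0.
rewrite muleA -EFinM ppow_gt0E// powRD; last by rewrite (gt_eqF x1) implybT.
by rewrite powR12_sqrt ?ltW// mulrC.
Qed.

Lemma integral_oneDsqrV : (\int[mu]_m ((1 + m ^+ 2)^-1)%:E = pi%:E)%E.
Proof.
have p m : 0 < 1 + m ^+ 2 by rewrite ltr_pwDl// sqr_ge0.
rewrite ge0_symfun_integralT//; last 3 first.
- by move=> m; rewrite invr_ge0 ltW.
- by move=> m; exact: continuous_oneDsqrV.
- by move=> m; rewrite /= sqrrN.
rewrite -set_itvcy; have := @integral0y_oneDsqr R; rewrite /oneDsqr => ->.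
by rewrite -EFinM mulrC divfK.
Qed.

(* Slopes [m = y / x] replace polar coordinates: [dx dy = x dm dx] and
   [x ^+ 2 + y ^+ 2 = x ^+ 2 * (1 + m ^+ 2)]. *)
Lemma disk_integralE a : -1 < a -> disk_integral a = (pi / (a + 1))%:E.
Proof.
move=> a1; have ap : 0 < a + 1 by lra.
have sx : measurable_fun [set: R * R] (fun z : R * R => z.1 ^+ 2).
  by apply: measurable_funX; exact: measurable_fst.
have sy : measurable_fun [set: R * R] (fun z : R * R => z.2 ^+ 2).
  by apply: measurable_funX; exact: measurable_snd.
rewrite disk_integral_iterated ge0_integral_even; last 3 first.
- apply: (@measurable_fun_fubini_tonelli_F _ _ (measurableTypeR R)
    (measurableTypeR R) R mu _
    (@measurable_disk_integrand a)) => z.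
  by rewrite lee_fin ppow_ge0.
- by move=> x; apply: integral_ge0 => y _; rewrite lee_fin ppow_ge0.
- by move=> x; apply: eq_integral => y _; rewrite sqrrN.
(* By symmetry only [x > 0] remains. The substitution [y = x * m] contributes the factor [x],
   written [ppow 1 x] so that it also carries the restriction to [x > 0]. *)
transitivity (2%:E * \int[mu]_x \int[mu]_m
    (ppow 1 x * ppow a (1 - x ^+ 2 * (1 + m ^+ 2)))%:E)%E.
  congr (_ * _)%E; apply: eq_integral => x _.
  have my : measurable_fun [set: R] (fun y => ppow a (1 - x ^+ 2 - y ^+ 2)).
    apply/measurable_ppow_comp/measurable_funB => //.
  have [x0|x0] := ltP 0 x; last first.
    rewrite (ppow_le0E _ x0) mul0e; apply/esym/integral0_eq => m _.
    by rewrite (ppow_le0E _ x0) mul0r.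
  rewrite ppow_gt0E// powRr0 mul1e (ge0_integral_scale x0); last 2 first.
  - exact/measurable_EFinP.
  - by move=> y; rewrite lee_fin ppow_ge0.
  rewrite ppow_gt0E// powRr1 ?ltW// ge0_integralZl_fin ?ltW//; last 2 first.
  - apply/measurable_ppow_comp/measurable_funB => //.
    apply: measurable_funM => //; apply: measurable_funD => //.
  - by move=> m; exact: ppow_ge0.
  congr (_ * _)%E; apply: eq_integral => m _.
  by congr (ppow _ _)%:E; ring.
rewrite ge0_integral_swap; last 2 first.
- apply: measurable_funM; first exact: measurable_ppow_comp measurable_fst_R.
  apply: measurable_ppow_comp; apply: measurable_funB => //.
  by apply: measurable_funM => //; apply: measurable_funD.
- by move=> x m; rewrite mulr_ge0 ?ppow_ge0.
(* For a fixed slope, scaling [x] by the inverse square root of [1 + m ^+ 2] reduces the inner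
   integral to the radial one. One square root comes from [dx] and one from the factor [x]. *)
transitivity (2%:E * \int[mu]_m ((2 * (a + 1))^-1 * (1 + m ^+ 2)^-1)%:E)%E.
  congr (_ * _)%E; apply: eq_integral => m _.
  have p : 0 < 1 + m ^+ 2 by rewrite ltr_pwDl// sqr_ge0.
  set q := 1 + m ^+ 2 in p *.
  have sq0 : 0 < (Num.sqrt q)^-1 by rewrite invr_gt0 sqrtr_gt0.
  have mg c : measurable_fun [set: R]
      (fun x => ppow 1 x * ppow a (1 - x ^+ 2 * c)).
    apply: measurable_funM; first exact: measurable_ppow.
    apply/measurable_ppow_comp/measurable_funB => //.
    exact: measurable_funM.
  rewrite (ge0_integral_scale sq0); last 2 first.
  - exact/measurable_EFinP.
  - by move=> x; rewrite lee_fin mulr_ge0 ?ppow_ge0.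
  transitivity ((Num.sqrt q)^-1%:E * \int[mu]_x
      ((Num.sqrt q)^-1 * (ppow 1 x * ppow a (1 - x ^+ 2)))%:E)%E.
    congr (_ * _)%E; apply: eq_integral => x _.
    rewrite ppowZ// powRr1 ?ltW// mulrA exprMn exprVn sqr_sqrtr ?ltW//.
    by rewrite (mulrAC q^-1) mulVf ?gt_eqF// mul1r.
  rewrite ge0_integralZl_fin ?ltW//; last 2 first.
  - by have := mg 1; under eq_fun do rewrite mulr1.
  - by move=> x; rewrite mulr_ge0 ?ppow_ge0.
  rewrite integral_ppow1_ppow// muleA -!EFinM -expr2 exprVn sqr_sqrtr ?ltW//.
  by rewrite mulrC.
rewrite ge0_integralZl_fin; last 3 first.
- by rewrite invr_ge0 mulr_ge0// ltW.
- apply: continuous_measurable_fun => m; exact: continuous_oneDsqrV.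
- by move=> m; rewrite invr_ge0 addr_ge0// sqr_ge0.
rewrite integral_oneDsqrV -!EFinM; congr EFin; field.
by rewrite gt_eqF.
Qed.

(** Euler's integral with values in the extended reals: unlike [Gamma], it keeps a divergent
    integral visible as [+oo], so identities can be proved without convergence arguments. *)
Definition egamma x : \bar R := (\int[mu]_t (ppow (x - 1) t * expR (- t))%:E)%E.

Lemma GammaE x : Gamma x = fine (egamma x).
Proof.
rewrite /Gamma /Rintegral /egamma integral_mkcond; congr fine.
apply: eq_integral => t _.
rewrite patchE mem_setE in_itv/= andbT /ppow; case: ifPn => // _.
by rewrite mul0r.
Qed.

Lemma measurable_expRN : measurable_fun [set: R] (fun t => expR (- t)).
Proof. by apply: measurableT_comp => //; exact: measurable_funN. Qed.

Lemma integral_expRN : (\int[mu]_t (ppow 0 t * expR (- t))%:E = 1)%E.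
Proof.
transitivity (\int[mu]_(t in `]0%R, +oo[) (expR (- t))%:E)%E.
  rewrite [RHS]integral_mkcond; apply: eq_integral => t _.
  rewrite patchE mem_setE in_itv/= andbT /ppow; case: ifPn => _.
    by rewrite powRr0 mul1r.
  by rewrite mul0r.
have cE : continuous (fun t => expR (- t)).
  move=> t; apply: continuous_comp; first exact: continuousN.
  exact: continuous_expR.
rewrite integral_itv_obnd_cbnd; last first.
  by apply/measurable_EFinP/measurable_funTS; exact: measurable_expRN.
rewrite (@ge0_continuous_FTC2y _ _ (fun t => - expR (- t)) _ 0)//.
- by rewrite oppr0 expR0 -EFinB opprK add0r.
- by apply: continuous_subspaceT.
- rewrite -oppr0; apply: cvgN; exact: cvgr_expR.
- by apply: cvg_at_right_filter; apply: cvgN; exact: cE.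
- move=> t _; rewrite derive1E; apply: derive_val.
  have h2 : is_derive t 1 (-%R : R -> R) (-1).
    by have := is_deriveN (is_derive_id t (1 : R)); apply.
  have h1 := @is_derive1_comp R expR -%R t _ _ (is_derive_expR (- t)) h2.
  by have := is_deriveN h1 => /is_derive_eq; apply; rewrite mulrN1 opprK.
Qed.

(** Tonelli takes the place of integration by parts: [t]^ (e + 1)[is]e + 1[times the integral of]s
    [^ e] over [0 < s < t], and after the exchange the integral of [expR (- t)] over [t > s] is
    [expR (- s)]. *)
Lemma egammaS e : -1 < e ->
  egamma (e + 2) = ((e + 1)%:E * egamma (e + 1))%E.
Proof.
move=> e1; have ep : 0 < e + 1 by lra.
rewrite /egamma addrK (_ : e + 2 - 1 = e + 1); last by ring.
have mxy : measurable_fun [set: R * R] (fun z : R * R => z.2 - z.1).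
  by apply: measurable_funB; [exact: measurable_snd|exact: measurable_fst].
have m2 t : measurable_fun [set: R] (fun s => ppow e s * ppow 0 (t - s)).
  apply: measurable_funM; first exact: measurable_ppow.
  exact/measurable_ppow_comp/measurable_funB.
transitivity (\int[mu]_t \int[mu]_s
    (((e + 1) * expR (- t)) * (ppow e s * ppow 0 (t - s)))%:E)%E.
  apply: eq_integral => t _.
  rewrite ge0_integralZl_fin//; last 2 first.
  - by rewrite mulr_ge0 ?expR_ge0 ?ltW.
  - by move=> s; rewrite mulr_ge0 ?ppow_ge0.
  rewrite integral_ppow_ppow0// -EFinM; congr EFin; field.
  by rewrite gt_eqF.
rewrite -(@ge0_integral_swap _ (fun s t =>
  ((e + 1) * expR (- t)) * (ppow e s * ppow 0 (t - s)))); last 2 first.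
- apply: measurable_funM.
    apply: measurable_funM => //.
    by apply: (measurableT_comp measurable_expRN); exact: measurable_snd.
  apply: measurable_funM; first exact: measurable_ppow_comp measurable_fst_R.
  exact: measurable_ppow_comp mxy.
- by move=> s t; rewrite !mulr_ge0 ?ppow_ge0 ?expR_ge0// ltW.
have mg : measurable_fun [set: R] (fun s => ppow e s * expR (- s)).
  by apply: measurable_funM; [exact: measurable_ppow|exact: measurable_expRN].
rewrite -ge0_integralZl_fin ?ltW//; last first.
  by move=> s; rewrite mulr_ge0 ?ppow_ge0 ?expR_ge0.
apply: eq_integral => s _.
rewrite (ge0_integral_shift s); last 2 first.
- apply/measurable_EFinP; apply: measurable_funM.
    by apply: measurable_funM => //; exact: measurable_expRN.
  apply: measurable_funM => //.
  exact/measurable_ppow_comp/measurable_funB.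
- by move=> t; rewrite lee_fin !mulr_ge0 ?ppow_ge0 ?expR_ge0// ltW.
transitivity (\int[mu]_t (((e + 1) * (ppow e s * expR (- s))) *
    (ppow 0 t * expR (- t)))%:E)%E.
  apply: eq_integral => t _; rewrite addrK opprD expRD; congr EFin; ring.
rewrite ge0_integralZl_fin; last 3 first.
- by rewrite !mulr_ge0 ?ppow_ge0 ?expR_ge0// ltW.
- by apply: measurable_funM; [exact: measurable_ppow|exact: measurable_expRN].
- by move=> t; rewrite mulr_ge0 ?ppow_ge0 ?expR_ge0.
by rewrite integral_expRN mule1.
Qed.

(** This is Euler's Beta integral at equal arguments. The square is a double integral in [s] and
    [t]; the sum [r = s + t] separates the exponential, and centring [s] at [r / 2] makes the
    remaining integral even. *)
Lemma egamma_sqr e :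
  (egamma (e + 1) * egamma (e + 1) =
   (2 `^ (- (2 * e + 1)))%:E * egamma (2 * e + 2) * slice_integral e)%E.
Proof.
rewrite /egamma !addrK (_ : 2 * e + 2 - 1 = 2 * e + 1); last by ring.
have mg e' : measurable_fun [set: R] (fun s => ppow e' s * expR (- s)).
  by apply: measurable_funM; [exact: measurable_ppow|exact: measurable_expRN].
have g0 e' s : 0 <= ppow e' s * expR (- s).
  by rewrite mulr_ge0 ?ppow_ge0 ?expR_ge0.
rewrite -ge0_integralZr//; last 3 first.
- by apply/measurable_EFinP; exact: mg.
- by move=> s _; rewrite lee_fin.
- by apply: integral_ge0 => s _; rewrite lee_fin.
transitivity (\int[mu]_s \int[mu]_r
    (expR (- r) * (ppow e s * ppow e (r - s)))%:E)%E.
  apply: eq_integral => s _; rewrite -ge0_integralZl_fin//.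
  rewrite (ge0_integral_shift (- s)).
  - apply: eq_integral => r _.
    have -> : expR (- r) = expR (- s) * expR (- (r - s)).
      by rewrite -expRD; congr expR; ring.
    by congr EFin; ring.
  - by apply/measurable_EFinP/measurable_funM => //; exact: mg.
  - by move=> r; rewrite lee_fin mulr_ge0.
rewrite ge0_integral_swap; last 2 first.
- apply: measurable_funM.
    by apply: (measurableT_comp measurable_expRN); exact: measurable_snd.
  apply: measurable_funM; first exact: measurable_ppow_comp measurable_fst_R.
  apply: measurable_ppow_comp.
  by apply: measurable_funB; [exact: measurable_snd|exact: measurable_fst].
- by move=> s r; rewrite !mulr_ge0 ?ppow_ge0 ?expR_ge0.
rewrite -ge0_integralZl_fin ?powR_ge0// -ge0_integralZr//; last 3 first.
- by apply/measurable_EFinP/measurable_funM => //; exact: mg.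
- by move=> s _; rewrite lee_fin mulr_ge0 ?powR_ge0.
- exact: slice_integral_ge0.
apply: eq_integral => r _.
have [r0|r0] := leP r 0.
  rewrite (ppow_le0E _ r0) mul0r mulr0 mul0e; apply: integral0_eq => s _.
  have [s0|s0] := leP s 0; first by rewrite (ppow_le0E _ s0) mul0r mulr0.
  by rewrite (@ppow_le0E _ _ (r - s)) ?mulr0// subr_le0 (le_trans r0)// ltW.
have r2 : 0 < r / 2 by rewrite divr_gt0.
rewrite (ge0_integral_affine (r / 2) r2); last 2 first.
- apply/measurable_EFinP; apply: measurable_funM => //.
  apply: measurable_funM; first exact: measurable_ppow.
  exact/measurable_ppow_comp/measurable_funB.
- by move=> s; rewrite lee_fin !mulr_ge0 ?ppow_ge0 ?expR_ge0.
(* With [s = r / 2 * (1 + u)], the product [s * (r - s)] becomes [(r / 2) ^+ 2 * (1 - u ^+ 2)], and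
   [0 < s < r] becomes [-1 < u < 1]. *)
transitivity ((r / 2)%:E * \int[mu]_u
  (expR (- r) * (r / 2) `^ (2 * e) * ppow e (1 - u ^+ 2))%:E)%E.
  congr (_ * _)%E; apply: eq_integral => u _; rewrite -ppow_mul_sym.
  rewrite (_ : r / 2 * u + r / 2 = r / 2 * (1 + u)); last by ring.
  rewrite (_ : r - r / 2 * (1 + u) = r / 2 * (1 - u)); last by field.
  rewrite !ppowZ// (_ : 2 * e = e + e); last by ring.
  rewrite powRD; last by rewrite (gt_eqF r2) implybT.
  congr EFin; ring.
rewrite ge0_integralZl_fin; last 3 first.
- by rewrite mulr_ge0 ?expR_ge0 ?powR_ge0.
- exact: measurable_ppow_sqr.
- by move=> u; exact: ppow_ge0.
rewrite muleA -EFinM; congr (_%:E * _)%E.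
rewrite ppow_gt0E// powRN.
have -> : r `^ (2 * e + 1) = 2 `^ (2 * e + 1) * (r / 2) `^ (2 * e + 1).
  by rewrite -powRM ?ltW// (mulrC 2 (r / 2)) divfK.
rewrite (@powRD _ (r / 2)); last by rewrite (gt_eqF r2) implybT.
rewrite powRr1 ?ltW//; field.
by rewrite gt_eqF// powR_gt0.
Qed.

End gamma_and_disk.

(** * The Gamma quotient as a ratio of slice integrals *)

Section gamma_quotient.
Variable R : realType.
Local Open Scope ring_scope.
Implicit Types a b e : R.

(** The product of [slice_integral e] and [slice_integral (e + 2^-1)] is a disk integral, hence
    finite and positive. A zero factor would make it 0; an infinite first factor would make it 0 or
    [+oo]. *)
Lemma slice_integral_fin e : -1 < e ->
  exists2 q : R, 0 < q & slice_integral e = q%:E.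
Proof.
move=> e1; have := disk_integralE e1; rewrite disk_integral_slices.
have p0 : 0 < pi / (e + 1) :> R by rewrite divr_gt0 ?pi_gt0//; lra.
have := slice_integral_ge0 e; have := slice_integral_ge0 (e + 2^-1).
case: (slice_integral e) => [q _ q0 h|s0 _|//].
  exists q => //; rewrite lt_neqAle -lee_fin q0 andbT; apply/eqP => q0'.
  by move: h; rewrite -q0' mul0e => -[] /eqP; rewrite lt_eqF.
move: s0; rewrite le_eqVlt => /predU1P[<-|s0].
  by rewrite mule0 => -[] /eqP; rewrite lt_eqF.
by rewrite gt0_mulye.
Qed.

(** The Beta identity at [e = a / 2] leaves [slice_integral (a / 2)]. Multiplied by
    [slice_integral ((a - 1) / 2)] it becomes the disk integral at [(a - 1) / 2], equal to
    [2 * pi / (a + 1)], and the functional equation cancels [a + 1]. *)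
Lemma egamma_sqr_slice a : -1 < a ->
  (egamma (1 + a / 2) * egamma (1 + a / 2) * slice_integral ((a - 1) / 2) =
   (pi / 2 `^ a)%:E * egamma (a + 1))%E.
Proof.
move=> a1; have ap : 0 < a + 1 by lra.
have h : -1 < (a - 1) / 2 by lra.
have := disk_integralE h; rewrite disk_integral_slices.
rewrite (_ : (a - 1) / 2 + 2^-1 = a / 2); last by field.
rewrite (_ : (a - 1) / 2 + 1 = (a + 1) / 2); last by field.
move=> hD.
have := egamma_sqr (a / 2).
rewrite (_ : 2 * (a / 2) = a); last by field.
rewrite addrC => ->; rewrite egammaS// -muleA (muleC (slice_integral _)) hD.
rewrite muleA -EFinM muleAC -EFinM; congr (_%:E * _)%E.
rewrite powRN powRD ?pnatr_eq0 ?implybT// powRr1//; field.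
by rewrite !gt_eqF ?powR_gt0.
Qed.

Lemma Gamma_quotient_le1 a b : -1 < a -> a < b ->
  1 / 2 `^ (b - a) * (Gamma (b + 1) / Gamma (a + 1))
    * (Gamma (1 + a / 2) / Gamma (1 + b / 2)) ^+ 2 <= 1.
Proof.
move=> a1 ab; have b1 : -1 < b by exact: lt_trans ab.
have [qa qa0 Ea] : exists2 q : R, 0 < q & slice_integral ((a - 1) / 2) = q%:E.
  by apply: slice_integral_fin; lra.
have [qb qb0 Eb] : exists2 q : R, 0 < q & slice_integral ((b - 1) / 2) = q%:E.
  by apply: slice_integral_fin; lra.
have qab : qb <= qa.
  rewrite -lee_fin -Ea -Eb; apply: slice_integral_nonincreasing.
  by rewrite ler_pM2r// lerD2r ltW.
have fin_Gamma x : Gamma x != 0 :> R -> egamma x = (Gamma x)%:E.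
  by rewrite GammaE; case: (egamma x) => //= /eqP.
have := egamma_sqr_slice a1; have := egamma_sqr_slice b1; rewrite Ea Eb.
(* A divergent Euler integral would make [Gamma] vanish by convention. *)
have [->|/[dup] A1 /fin_Gamma ->] := eqVneq (Gamma (a + 1)) 0.
  by rewrite invr0 mulr0 mulr0 mul0r ler01.
have [->|/[dup] B1 /fin_Gamma ->] := eqVneq (Gamma (b + 1)) 0.
  by rewrite mul0r mulr0 mul0r.
have [->|/[dup] A2 /fin_Gamma ->] := eqVneq (Gamma (1 + a / 2)) 0.
  by rewrite mul0r expr0n mulr0.
have [->|/[dup] B2 /fin_Gamma ->] := eqVneq (Gamma (1 + b / 2)) 0.
  by rewrite invr0 mulr0 expr0n mulr0.
rewrite -!EFinM => -[hb] [ha].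
have p2 e : 0 < 2 `^ e :> R by exact: powR_gt0.
move: (pi : R) (pi_gt0 R) ha hb => p p0 ha hb.
have h x y z w : 0 < w -> x * x * y = p / w * z -> z = x ^+ 2 * y * w / p.
  move=> w0 hz; rewrite expr2 hz; field.
  by rewrite !gt_eqF.
(* Once [Gamma (a + 1)] and [Gamma (b + 1)] are expressed through the slice integrals, the Gamma
   values at [1 + a / 2] and [1 + b / 2], the powers of 2 and [pi] all cancel, leaving [qb / qa]. *)
rewrite (h _ _ _ _ (p2 _) ha) (h _ _ _ _ (p2 _) hb).
rewrite powRB ?pnatr_eq0 ?implybT//.
rewrite [leLHS](_ : _ = qb / qa); first by rewrite ler_pdivrMr// mul1r.
by field; rewrite A2 B2 !gt_eqF.
Qed.

End gamma_quotient.

(** * Norms of the constant function 1 *)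

Section constant_multiplier.
Variable R : realType.
Local Open Scope classical_set_scope.
Local Open Scope ring_scope.
Local Open Scope complex_scope.
Local Notation mu := (@lebesgue_measure R).
Implicit Types a b c : R.
Local Notation one := (fun=> 1 : R[i]).

Lemma analytic_one : analytic R one.
Proof. by move=> z _; exact: derivable_cst. Qed.

Lemma cmod0 : cmod (0 : R[i]) = 0.
Proof. by rewrite /= expr0n/= addr0 sqrtr0. Qed.

Lemma cmod1 : cmod (1 : R[i]) = 1.
Proof. by rewrite /= expr1n expr0n/= addr0 sqrtr1. Qed.

Lemma unit_disk0 : unit_disk R 0.
Proof. by rewrite /unit_disk /mkset cmod0. Qed.

Lemma cmod_ge0 (z : R[i]) : 0 <= cmod z.
Proof. by case: z => x y; exact: sqrtr_ge0. Qed.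

Lemma sqr_cmod (x y : R) : cmod (x +i* y) ^+ 2 = x ^+ 2 + y ^+ 2.
Proof. by rewrite /= sqr_sqrtr// addr_ge0// sqr_ge0. Qed.

Lemma bergman_normsq_one a : -1 < a -> bergman_normsq a one = 1%E.
Proof.
move=> a1; have ap : 0 < a + 1 by lra.
rewrite /bergman_normsq integral_mkcond.
transitivity ((a + 1)%:E * \int[mu \x mu]_p
    (pi^-1 * ppow a (1 - p.1 ^+ 2 - p.2 ^+ 2))%:E)%E.
  congr (_ * _)%E; apply: eq_integral => -[x y] _.
  rewrite patchE /ppow /fst /snd cmod1 expr1n mul1r sqr_cmod.
  (* The disk is exactly where [1 - x ^+ 2 - y ^+ 2] is positive, so the restriction of the domain
     agrees with the cut-off in [ppow]. *)
  have <- : ((x, y) \in [set p : R * R | unit_disk R (p.1 +i* p.2)]) =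
      (0 < 1 - x ^+ 2 - y ^+ 2).
    rewrite -addrA -opprD -sqr_cmod subr_gt0 expr_lt1 ?cmod_ge0//.
    by apply/idP/idP; rewrite inE.
  case: ifPn => _; last by rewrite mulr0.
  by rewrite opprD addrA mulrC.
under eq_integral do rewrite EFinM.
rewrite ge0_integralZl//; last 3 first.
- exact: measurable_disk_integrand.
- by move=> z _; rewrite lee_fin ppow_ge0.
- by rewrite lee_fin invr_ge0 pi_ge0.
rewrite -/(disk_integral a) disk_integralE// -!EFinM.
by rewrite mulKf ?mulfV ?gt_eqF ?pi_gt0.
Qed.

(** For a positive exponent the weight is at most 1 on the disk, and it equals 1 at the origin. *)
Lemma growth_norm_one c : 0 < c -> growth_norm c one = 1%E.
Proof.
move=> c0; apply/eqP; rewrite eq_le; apply/andP; split.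
  apply: ge_ereal_sup => _ [z zD <-].
  rewrite lee_fin cmod1 mul1r.
  have := @ger_powR _ (1 - cmod z ^+ 2) _ 0 c (ltW c0).
  rewrite powRr0; apply.
  by rewrite subr_gt0 expr_lt1 ?cmod_ge0// [cmod z < 1]zD/=
     lerBlDr lerDl sqr_ge0.
apply: le_ereal_sup_tmp; exists 1%E => //.
exists 0; first exact: unit_disk0.
rewrite cmod1 cmod0 mul1r.
by rewrite expr0n/= subr0 powR1.
Qed.

Lemma sup_multiplier_norm_ge1 a b : -1 < a -> a < b ->
  (1 <= sup_multiplier_norm a b)%E.
Proof.
move=> a1 ab; have b1 : -1 < b by exact: lt_trans ab.
have c0 : 0 < (b - a) / 2 by rewrite divr_gt0 ?subr_gt0.
have norm1 c : -1 < c -> bergman_norm c one = 1%E.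
  by move=> c1; rewrite /bergman_norm bergman_normsq_one// poweR1r.
apply: le_ereal_sup_tmp; exists (multiplier_norm a b one).
  exists one => //; split; last exact: growth_norm_one.
  by split; [exact: analytic_one|rewrite growth_norm_one// ltry].
apply: le_ereal_sup_tmp; exists 1%E => //; exists one.
  split; last by exists 0; [exact: unit_disk0|exact/eqP/oner_neq0].
  by split; [exact: analytic_one|rewrite bergman_normsq_one// ltry].
(* The product of multiplier and test function is again the constant 1, so the quotient of norms is
   [1 / 1]. *)
under eq_fun do rewrite mulr1.
by rewrite !norm1// inve1 mule1.
Qed.

End constant_multiplier.

Theorem corollary1p10 (R : realType) (alpha beta : R)
    (halpha : -1 < alpha) (hbeta : alpha < beta) :
  ((1 / 2 `^ (beta - alpha) * (Gamma (beta + 1) / Gamma (alpha + 1))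
    * (Gamma (1 + alpha / 2) / Gamma (1 + beta / 2)) ^+ 2)%:E
   <= sup_multiplier_norm alpha beta ^+ 2)%E.
Proof.
apply: (@le_trans _ _ 1%E).
  by rewrite lee_fin; exact: Gamma_quotient_le1.
have M1 := sup_multiplier_norm_ge1 halpha hbeta.
by rewrite expe2 -(mule1 1%E) lee_pmul.
Qed.
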